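(* Let $E$ be an elliptic curve over $\mathbb{Q}$ whose Mordell–Weil group $E(\mathbb{Q})$ has rank $r\ge 1$, and let $\Gamma$ be a subgroup of $E(\mathbb{Q})$ of rank $s=0$. Then for every sufficiently large real $x$ and every $x$-pseudolinearly dependent point $Q$ of $\Gamma$ we have $$\hat{h}(Q)\ge \frac{1}{\#\Gamma}\,\frac{x}{\log x}+O\big(x/(\log x)^2\big).$$
   Context: For a prime $p$ of good reduction of $E$ (i.e. $p\nmid \Delta_E$), $\Gamma_p\subseteq E(\mathbb{F}_p)$ denotes the image of $\Gamma$ under reduction modulo $p$. A point $Q\in E(\mathbb{Q})$ is an $x$-pseudolinearly dependent point of $\Gamma$ if $Q\notin\Gamma$ but, for every prime $p\le x$ of good reduction, the reduction of $Q$ modulo $p$ lies in $\Gamma_p$. $\hat{h}$ denotes the canonical (Néron–Tate) height on $E(\mathbb{Q})$. The implied constant in $O$ depends only on $E$ and $\Gamma$. *)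

(* Defs.v *)
From HB Require Import structures.
From mathcomp Require Import all_boot all_order all_algebra.
From mathcomp Require Import all_classical all_reals all_analysis.
Import Order.TTheory GRing.Theory Num.Theory.
Import numFieldNormedType.Exports.

Set Implicit Arguments.
Unset Strict Implicit.
Unset Printing Implicit Defensive.

Local Open Scope classical_set_scope.
Local Open Scope ring_scope.

(* y^2 + a1 x y + a3 y = x^3 + a2 x^2 + a4 x + a6 *)
Record weierstrass (A : Type) : Type :=
  Weierstrass { a1 : A; a2 : A; a3 : A; a4 : A; a6 : A }.

Definition map_weierstrass (A B : Type) (f : A -> B) (W : weierstrass A) :
    weierstrass B :=
  Weierstrass (f (a1 W)) (f (a2 W)) (f (a3 W)) (f (a4 W)) (f (a6 W)).

Definition discriminant (A : comNzRingType) (W : weierstrass A) : A :=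
  let b2 := a1 W ^+ 2 + 4 * a2 W in
  let b4 := 2 * a4 W + a1 W * a3 W in
  let b6 := a3 W ^+ 2 + 4 * a6 W in
  let b8 := a1 W ^+ 2 * a6 W + 4 * a2 W * a6 W - a1 W * a3 W * a4 W
            + a2 W * a3 W ^+ 2 - a4 W ^+ 2 in
  - b2 ^+ 2 * b8 - 8 * b4 ^+ 3 - 27 * b6 ^+ 2 + 9 * b2 * b4 * b6.

(* [None] is the point at infinity.  Points are not constrained to lie on a
   curve; [ec_points W] is the set of those that do, and the operations below
   are only meaningful there. *)
Notation ec_point F := (option (F * F)%type).

Section GroupLaw.
Variables (F : fieldType) (W : weierstrass F).

Definition ec_points : set (ec_point F) :=
  [set P | match P with
           | None => True
           | Some (x, y) => y ^+ 2 + a1 W * x * y + a3 W * y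
                            = x ^+ 3 + a2 W * x ^+ 2 + a4 W * x + a6 W
           end].

Definition ec_opp (P : ec_point F) : ec_point F :=
  match P with
  | None => None
  | Some (x, y) => Some (x, - y - a1 W * x - a3 W)
  end.

Definition ec_add (P Q : ec_point F) : ec_point F :=
  match P, Q with
  | None, _ => Q
  | _, None => P
  | Some (x1, y1), Some (x2, y2) =>
    if (x1 == x2) && (y1 + y2 + a1 W * x2 + a3 W == 0) then None else
    let l := if x1 == x2
             then (3 * x1 ^+ 2 + 2 * a2 W * x1 + a4 W - a1 W * y1)
                  / (2 * y1 + a1 W * x1 + a3 W)
             else (y2 - y1) / (x2 - x1) in
    let x3 := l ^+ 2 + a1 W * l - a2 W - x1 - x2 in
    Some (x3, - (l + a1 W) * x3 - (y1 - l * x1) - a3 W)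
  end.

Definition ec_muln (n : nat) (P : ec_point F) : ec_point F :=
  iter n (ec_add P) None.

Definition ec_mulz (m : int) (P : ec_point F) : ec_point F :=
  match m with
  | Posz n => ec_muln n P
  | Negz n => ec_opp (ec_muln n.+1 P)
  end.

Definition ec_subgroup (G : set (ec_point F)) : Prop :=
  [/\ G `<=` ec_points, G None,
      (forall P Q, G P -> G Q -> G (ec_add P Q)) &
      (forall P, G P -> G (ec_opp P))].

Definition ec_independent (n : nat) (P : 'I_n -> ec_point F) : Prop :=
  forall c : 'I_n -> int,
    \big[ec_add/None]_(i < n) ec_mulz (c i) (P i) = None ->
    forall i, c i = 0.

(* The rank of a group of points is the maximal number of its elements that are
   linearly independent over the integers. *)
Definition has_rank (G : set (ec_point F)) (r : nat) : Prop :=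
  (exists P : 'I_r -> ec_point F, (forall i, G (P i)) /\ ec_independent P) /\
  (forall (n : nat) (P : 'I_n -> ec_point F),
     (forall i, G (P i)) -> ec_independent P -> (n <= r)%N).

End GroupLaw.

(* The base change to the rationals of an integral Weierstrass equation. *)
Definition over_rat (E : weierstrass int) : weierstrass rat :=
  map_weierstrass intr E.

(* A rational point with p-integral coordinates reduces coordinatewise, [ratr]
   being numq / denq computed in 'F_p; the others reduce to the point at
   infinity.  On the curve, p divides the denominator of x if and only if it
   divides that of y. *)
Definition reduction (p : nat) (P : ec_point rat) : ec_point 'F_p :=
  match P with
  | None => None
  | Some (x, y) =>
    if (p%:Z %| denq x)%Z then None else Some (ratr x, ratr y)
  end.

Definition good_prime (E : weierstrass int) (p : nat) : Prop :=
  prime p /\ ~~ (p%:Z %| discriminant E)%Z.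

Definition pseudolinearly_dependent (R : realType) (E : weierstrass int)
    (Gamma : set (ec_point rat)) (x : R) (Q : ec_point rat) : Prop :=
  [/\ ec_points (over_rat E) Q, ~ Gamma Q &
      forall p : nat, good_prime E p -> p%:R <= x ->
        (reduction p @` Gamma) (reduction p Q)].

(* The logarithmic Weil height of the x-coordinate. *)
Definition naive_height (R : realType) (P : ec_point rat) : R :=
  match P with
  | None => 0
  | Some (x, _) => ln ((maxn `|numq x|%N `|denq x|%N)%:R)
  end.

(* Normalized by the factor 1/2, so that it differs by a bounded amount from
   half the height of the x-coordinate. *)
Definition canonical_height (R : realType) (W : weierstrass rat)
    (P : ec_point rat) : R :=
  2^-1 * limn (fun N : nat => naive_height R (ec_muln W (2 ^ N) P) / 4 ^+ N).

(* Main.v *)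
(* If p is a good prime up to x then Q and some T in Gamma have the same
   reduction, so p divides the denominator of x(Q) or the numerator of
   x(Q) - x(T), which is nonzero since Q is neither T nor -T. Hence the primorial
   of x divides a nonzero integer whose logarithm is at most
   (#Gamma + 1) h(Q) + O(1), where h is the naive height. As h(2P) = 4 h(P) + O(1)
   on the curve, the canonical height is at least h / 2 - O(1). Finally Chebyshev's
   estimate makes the logarithm of the primorial at least a constant times x,
   which exceeds any multiple of x / log x.

   Of the group law only 2^(n+1) P = 2 (2^n P) is needed; it follows from the
   special case (P + A) + A = P + (A + A) of associativity. *)

Require Import Defs.
From mathcomp Require Import all_boot all_order all_algebra finmap.
From mathcomp Require Import all_classical all_reals all_analysis.
From mathcomp Require Import ring lra.
Import Order.TTheory GRing.Theory Num.Theory.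
Import numFieldNormedType.Exports.
Local Open Scope classical_set_scope.
Local Open Scope ring_scope.

Set Implicit Arguments.
Unset Strict Implicit.
Unset Printing Implicit Defensive.

(** * Chords and tangents *)

(** The last two equations say that both partial derivatives vanish. Together with the curve
    equation they express [a6], [a4] and [a3] through the remaining quantities, and the discriminant
    then vanishes identically. *)
Lemma nonsingular (F : fieldType) (W : weierstrass F) (x y : F) :
  discriminant W != 0 -> ec_points W (Some (x, y)) ->
  2 * y + a1 W * x + a3 W = 0 ->
  3 * x ^+ 2 + 2 * a2 W * x + a4 W - a1 W * y = 0 -> False.
Proof.
case: W => b1 b2 b3 b4 b6; rewrite /ec_points /discriminant /= => D0 E u0 v0.
move/eqP: D0; apply.
have -> : b6 = y ^+ 2 + b1 * x * y + b3 * y - (x ^+ 3 + b2 * x ^+ 2 + b4 * x).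
  by rewrite E; ring.
have -> : b4 = b1 * y - 3 * x ^+ 2 - 2 * b2 * x by rewrite -[LHS](addr0) -{1}oppr0 -v0; ring.
have -> : b3 = - 2 * y - b1 * x by rewrite -[LHS](addr0) -{1}oppr0 -u0; ring.
ring.
Qed.

(* The line y = l x + n meets the curve at x1, x2, x3, with multiplicities. *)
Definition line_meets (F : fieldType) (W : weierstrass F) (l n x1 x2 x3 : F) :=
  [/\ x1 + x2 + x3 = l ^+ 2 + a1 W * l - a2 W,
      x1 * x2 + x1 * x3 + x2 * x3 = a4 W - a1 W * n - a3 W * l - 2 * l * n &
      x1 * x2 * x3 = n ^+ 2 + a3 W * n - a6 W].

Lemma line_meets_rot (F : fieldType) (W : weierstrass F) (l n x1 x2 x3 : F) :
  line_meets W l n x1 x2 x3 -> line_meets W l n x2 x3 x1.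
Proof. by case=> e1 e2 e3; split; rewrite -?e1 -?e2 -?e3; ring. Qed.

Lemma line_meets_swap (F : fieldType) (W : weierstrass F) (l n x1 x2 x3 : F) :
  line_meets W l n x1 x2 x3 -> line_meets W l n x2 x1 x3.
Proof. by case=> e1 e2 e3; split; rewrite -?e1 -?e2 -?e3; ring. Qed.

(** Substituting the line into the curve gives the monic cubic with roots x1, x2, x3, whose
    coefficients are those in [line_meets]. *)
Lemma line_meets_point (F : fieldType) (W : weierstrass F) (l n x1 x2 x3 : F) :
  line_meets W l n x1 x2 x3 -> ec_points W (Some (x1, l * x1 + n)).
Proof.
case: W => b1 b2 b3 b4 b6; rewrite /line_meets /= => -[e1 e2 e3].
have -> : b2 = l ^+ 2 + b1 * l - (x1 + x2 + x3) by rewrite e1; ring.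
have -> : b4 = x1 * x2 + x1 * x3 + x2 * x3 + b1 * n + b3 * l + 2 * l * n.
  by rewrite e2; ring.
have -> : b6 = n ^+ 2 + b3 * n - x1 * x2 * x3 by rewrite e3; ring.
ring.
Qed.

Lemma add_of_line_meets (F : fieldType) (W : weierstrass F) (l n x1 x2 x3 : F) :
  discriminant W != 0 -> line_meets W l n x1 x2 x3 ->
  ec_add W (Some (x1, l * x1 + n)) (Some (x2, l * x2 + n)) =
  ec_opp W (Some (x3, l * x3 + n)).
Proof.
move=> D0 H; have E1 := line_meets_point H.
rewrite /ec_add.
have [e12|ne12] := eqVneq x1 x2; last first.
  have d0 : x2 - x1 != 0 by rewrite subr_eq0 eq_sym.
  have -> /= : (l * x2 + n - (l * x1 + n)) / (x2 - x1) = l by field.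
  case: H => e1 e2 e3.
  have -> : l ^+ 2 + a1 W * l - a2 W - x1 - x2 = x3 by rewrite -e1; ring.
  by congr (Some (_, _)); ring.
subst x2.
(* As x1 is a double root, l satisfies the equation of the tangent slope. If its denominator
   vanished, so would its numerator, and the point would be singular. *)
have V : 3 * x1 ^+ 2 + 2 * a2 W * x1 + a4 W - a1 W * (l * x1 + n) =
         l * (2 * (l * x1 + n) + a1 W * x1 + a3 W).
  case: (H) => e1 e2 e3.
  have -> : a2 W = l ^+ 2 + a1 W * l - (x1 + x1 + x3) by rewrite e1; ring.
  have -> : a4 W = x1 * x1 + x1 * x3 + x1 * x3 + a1 W * n + a3 W * l + 2 * l * n.
    by rewrite e2; ring.
  ring.
have [u0|u0] /= := eqVneq (l * x1 + n + (l * x1 + n) + a1 W * x1 + a3 W) 0.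
  have u0' : 2 * (l * x1 + n) + a1 W * x1 + a3 W = 0 by rewrite -u0; ring.
  by case: (nonsingular D0 E1 u0'); rewrite V u0' mulr0.
have u0' : 2 * (l * x1 + n) + a1 W * x1 + a3 W != 0.
  by apply: contra_neq u0 => <-; ring.
rewrite V mulfK //.
case: H => e1 e2 e3.
have -> : l ^+ 2 + a1 W * l - a2 W - x1 - x1 = x3 by rewrite -e1; ring.
by congr (Some (_, _)); ring.
Qed.

(** The difference of the two curve equations factors as (y1 - y2) (y1 + y2 + a1 x + a3). *)
Lemma ec_eq_or_opp (F : fieldType) (W : weierstrass F) (x y1 y2 : F) :
  ec_points W (Some (x, y1)) -> ec_points W (Some (x, y2)) ->
  y1 = y2 \/ y1 + y2 + a1 W * x + a3 W = 0.
Proof.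
move=> /= E1 E2; apply/or_comm; case: (eqVneq y1 y2) => [|ne]; first by right.
left; have d : y1 - y2 != 0 by rewrite subr_eq0.
apply: (mulfI d); rewrite mulr0.
have : y1 ^+ 2 + a1 W * x * y1 + a3 W * y1 - (y2 ^+ 2 + a1 W * x * y2 + a3 W * y2) = 0.
  by rewrite E1 E2 subrr.
by move=> <-; ring.
Qed.

(** * Opposites, closure, commutativity and cancellation *)

Lemma ec_oppK (F : fieldType) (W : weierstrass F) : involutive (ec_opp W).
Proof. by case=> [[x y]|] //=; congr (Some (_, _)); ring. Qed.

Lemma ec_opp_point (F : fieldType) (W : weierstrass F) P :
  ec_points W P -> ec_points W (ec_opp W P).
Proof. by case: P => [[x y]|] //= E; rewrite -E; ring. Qed.

Lemma ec_addN (F : fieldType) (W : weierstrass F) P : ec_add W P (ec_opp W P) = None.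
Proof.
case: P => [[x y]|] //=; rewrite eqxx /=.
suff -> : y + (- y - a1 W * x - a3 W) + a1 W * x + a3 W = 0 by rewrite eqxx.
ring.
Qed.

Lemma ec_addNl (F : fieldType) (W : weierstrass F) P : ec_add W (ec_opp W P) P = None.
Proof. by have := ec_addN W (ec_opp W P); rewrite ec_oppK. Qed.

Lemma ec_addP0 (F : fieldType) (W : weierstrass F) P : ec_add W P None = P.
Proof. by case: P => [[x y]|]. Qed.

Lemma ec_add_eq0 (F : fieldType) (W : weierstrass F) P Q :
  ec_points W P -> ec_points W Q ->
  ec_add W P Q = None -> Q = ec_opp W P.
Proof.
case: P => [[x1 y1]|]; last by move=> _ _ /= ->.
case: Q => [[x2 y2]|] // E1 E2 /=.
case: ifP => // /andP[/eqP e12 /eqP u0] _; subst x2.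
by congr (Some (_, _)); rewrite -[LHS]subr0 -u0; ring.
Qed.

(** Converse of [add_of_line_meets]. The two together reduce identities between sums to the symmetry
    of [line_meets]. *)
Lemma ec_add_line (F : fieldType) (W : weierstrass F) x1 y1 x2 y2 x3 y3 :
  ec_points W (Some (x1, y1)) -> ec_points W (Some (x2, y2)) ->
  ec_add W (Some (x1, y1)) (Some (x2, y2)) = ec_opp W (Some (x3, y3)) ->
  exists l n, [/\ y1 = l * x1 + n, y2 = l * x2 + n, y3 = l * x3 + n &
                  line_meets W l n x1 x2 x3].
Proof.
move=> E1 E2; rewrite /ec_add.
have [e12|ne12] := eqVneq x1 x2.
  subst x2; have [u0|u0] //= := eqVneq (y1 + y2 + a1 W * x1 + a3 W) 0.
  have e : y1 = y2 by case: (ec_eq_or_opp E1 E2) => // u0'; rewrite u0' eqxx in u0.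
  subst y2.
  have u0' : 2 * y1 + a1 W * x1 + a3 W != 0.
    by apply: contra_neq u0 => <-; ring.
  set l := _ / _.
  have V : 3 * x1 ^+ 2 + 2 * a2 W * x1 + a4 W - a1 W * y1 =
           l * (2 * y1 + a1 W * x1 + a3 W) by rewrite divfK.
  case=> ex3 ey3; exists l, (y1 - l * x1); split=> //; try ring.
    rewrite -[LHS]opprK.
    have -> : - y3 = - (l + a1 W) * (l ^+ 2 + a1 W * l - a2 W - x1 - x1) -
                     (y1 - l * x1) - a3 W + a1 W * x3 + a3 W by rewrite ey3; ring.
    by rewrite ex3; ring.
  clearbody l; case: W E1 E2 u0 u0' V ex3 ey3 => b1 b2 b3 b4 b6 /= E1 _ _ _ V ex3 _.
  rewrite -ex3.
  have -> : b6 = y1 ^+ 2 + b1 * x1 * y1 + b3 * y1 - (x1 ^+ 3 + b2 * x1 ^+ 2 + b4 * x1).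
    by rewrite E1; ring.
  have -> : b4 = l * (2 * y1 + b1 * x1 + b3) - 3 * x1 ^+ 2 - 2 * b2 * x1 + b1 * y1.
    by rewrite -V; ring.
  by split=> /=; ring.
rewrite [_ && _]/=.
have d0 : x2 - x1 != 0 by rewrite subr_eq0 eq_sym.
set l := _ / _.
have L : y2 = y1 + l * (x2 - x1) by rewrite divfK // addrC subrK.
case=> ex3 ey3; exists l, (y1 - l * x1); split=> //; try by rewrite ?L; ring.
  rewrite -[LHS]opprK.
  have -> : - y3 = - (l + a1 W) * (l ^+ 2 + a1 W * l - a2 W - x1 - x2) -
                   (y1 - l * x1) - a3 W + a1 W * x3 + a3 W by rewrite ey3; ring.
  by rewrite ex3; ring.
clearbody l; subst y2.
case: W E1 E2 ex3 ey3 => b1 b2 b3 b4 b6 /= E1 E2 ex3 _.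
rewrite -ex3.
have E6 : b6 = y1 ^+ 2 + b1 * x1 * y1 + b3 * y1 - (x1 ^+ 3 + b2 * x1 ^+ 2 + b4 * x1).
  by rewrite E1; ring.
(* The difference of the two curve equations is divisible by x2 - x1; the quotient gives [a4]. *)
have E4 : b4 = l * (y1 + l * (x2 - x1) + y1) + b1 * (y1 + l * x2) + b3 * l -
  (x1 ^+ 2 + x1 * x2 + x2 ^+ 2) - b2 * (x1 + x2).
  apply: (mulfI d0); apply/eqP; rewrite -subr_eq0; apply/eqP.
  rewrite E6 in E2; move/eqP: E2; rewrite -subr_eq0 => /eqP E2.
  by rewrite -[RHS]oppr0 -[in RHS]E2; ring.
rewrite E6 E4.
by split=> /=; ring.
Qed.

(** Negation keeps abscissae and carries lines to lines; the new slope and intercept are those in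
    [ec_opp_line]. *)
Lemma line_meets_opp (F : fieldType) (W : weierstrass F) (l n x1 x2 x3 : F) :
  line_meets W l n x1 x2 x3 -> line_meets W (- l - a1 W) (- n - a3 W) x1 x2 x3.
Proof. by case=> e1 e2 e3; split; rewrite ?e1 ?e2 ?e3; ring. Qed.

Lemma ec_opp_line (F : fieldType) (W : weierstrass F) (l n x : F) :
  ec_opp W (Some (x, l * x + n)) = Some (x, (- l - a1 W) * x + (- n - a3 W)).
Proof. by congr (Some (_, _)); ring. Qed.

Lemma ec_add_point (F : fieldType) (W : weierstrass F) P Q :
  ec_points W P -> ec_points W Q -> ec_points W (ec_add W P Q).
Proof.
case: P => [[x1 y1]|] //; case: Q => [[x2 y2]|] // E1 E2.
rewrite -(ec_oppK W (ec_add _ _ _)); apply: ec_opp_point.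
case e: (ec_opp W _) => [[x3 y3]|] //.
have {}e : ec_add W (Some (x1, y1)) (Some (x2, y2)) = ec_opp W (Some (x3, y3)).
  by rewrite -e ec_oppK.
have [l [n [_ _ -> L]]] := ec_add_line E1 E2 e.
exact: line_meets_point (line_meets_rot (line_meets_rot L)).
Qed.

Lemma ec_addC (F : fieldType) (W : weierstrass F) P Q :
  discriminant W != 0 -> ec_points W P -> ec_points W Q ->
  ec_add W P Q = ec_add W Q P.
Proof.
move=> D0; case: P => [[x1 y1]|]; case: Q => [[x2 y2]|] // E1 E2.
case e: (ec_add W (Some (x1, y1)) _) => [[x3 y3]|]; last first.
  by rewrite (ec_add_eq0 E1 E2 e) ec_addNl.
have : ec_add W (Some (x1, y1)) (Some (x2, y2)) = ec_opp W (ec_opp W (Some (x3, y3))).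
  by rewrite ec_oppK.
rewrite [X in _ = ec_opp _ X]/=; move/(ec_add_line E1 E2) => [l [n [-> -> ey L]]].
have := add_of_line_meets D0 (line_meets_swap L).
rewrite -ey => ->; rewrite -[RHS](ec_oppK W).
by congr (Some (_, _)); ring.
Qed.

Lemma ec_oppD (F : fieldType) (W : weierstrass F) P Q :
  discriminant W != 0 -> ec_points W P -> ec_points W Q ->
  ec_add W (ec_opp W P) (ec_opp W Q) = ec_opp W (ec_add W P Q).
Proof.
move=> D0; case: P => [[x1 y1]|] //; case: Q => [[x2 y2]|] // E1 E2.
case e: (ec_opp W (ec_add _ _ _)) => [[x3 y3]|]; last first.
  have {}e : ec_add W (Some (x1, y1)) (Some (x2, y2)) = None.
    by rewrite -[LHS](ec_oppK W) e.
  by rewrite (ec_add_eq0 E1 E2 e) ec_oppK ec_addNl.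
have {}e : ec_add W (Some (x1, y1)) (Some (x2, y2)) = ec_opp W (Some (x3, y3)).
  by rewrite -e ec_oppK.
have [l [n [-> -> -> L]]] := ec_add_line E1 E2 e.
rewrite !ec_opp_line (add_of_line_meets D0 (line_meets_opp L)).
by rewrite -ec_opp_line ec_oppK.
Qed.

(** P, Q and R = -(P + Q) are collinear, so P + R = -Q; negate this. No associativity is
    involved. *)
Lemma ec_addNK (F : fieldType) (W : weierstrass F) P Q :
  discriminant W != 0 -> ec_points W P -> ec_points W Q ->
  ec_add W (ec_opp W P) (ec_add W P Q) = Q.
Proof.
move=> D0; case: P => [[x1 y1]|] //; case: Q => [[x2 y2]|] E1 E2; last first.
  by rewrite ec_addP0 ec_addNl.
case e: (ec_opp W (ec_add W (Some (x1, y1)) _)) => [[x3 y3]|]; last first.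
  have {}e : ec_add W (Some (x1, y1)) (Some (x2, y2)) = None.
    by rewrite -[LHS](ec_oppK W) e.
  by rewrite e ec_addP0 (ec_add_eq0 E1 E2 e).
have {}e : ec_add W (Some (x1, y1)) (Some (x2, y2)) = ec_opp W (Some (x3, y3)).
  by rewrite -e ec_oppK.
have [l [n [ey1 ey2 ey3 L]]] := ec_add_line E1 E2 e.
have L' := line_meets_swap (line_meets_rot (line_meets_rot L)).
rewrite e ec_oppD // ?ey1 ?ey2 ?ey3 ?(add_of_line_meets D0 L') ?ec_oppK //.
exact: line_meets_point (line_meets_rot (line_meets_rot L)).
Qed.

Lemma ec_add_eqE (F : fieldType) (W : weierstrass F) P Q S :
  discriminant W != 0 -> ec_points W P -> ec_points W Q ->
  ec_add W P Q = S -> Q = ec_add W (ec_opp W P) S.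
Proof. by move=> D0 E1 E2 <-; rewrite ec_addNK. Qed.

(** * Associativity for a repeated summand *)

Lemma ec_add_chord (F : fieldType) (W : weierstrass F) x1 y1 x2 y2 :
  x1 != x2 ->
  let l := (y2 - y1) / (x2 - x1) in
  let x3 := l ^+ 2 + a1 W * l - a2 W - x1 - x2 in
  ec_add W (Some (x1, y1)) (Some (x2, y2)) =
  Some (x3, - (l + a1 W) * x3 - (y1 - l * x1) - a3 W).
Proof. by move=> /negbTE ne; rewrite /ec_add ne. Qed.

Lemma ec_add_tangent (F : fieldType) (W : weierstrass F) x y :
  2 * y + a1 W * x + a3 W != 0 ->
  let l := (3 * x ^+ 2 + 2 * a2 W * x + a4 W - a1 W * y)
                  / (2 * y + a1 W * x + a3 W) in
  let x3 := l ^+ 2 + a1 W * l - a2 W - x - x in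
  ec_add W (Some (x, y)) (Some (x, y)) =
  Some (x3, - (l + a1 W) * x3 - (y - l * x) - a3 W).
Proof.
move=> u0; rewrite /ec_add eqxx /=.
suff -> : y + y + a1 W * x + a3 W = 2 * y + a1 W * x + a3 W by rewrite (negbTE u0).
ring.
Qed.

(* If the chord and the tangent at x2 have slopes l and m, then everything is a
   polynomial in a1, l, m, x1, x2, the ordinate at x2 and
   w = (2 * y2 + a1 * x2 + a3) / (x1 - x2), with no relation left between them:
   this turns the associativity identities below into identities that [field]
   proves. *)
Lemma chord_tangent (F : fieldType) (W : weierstrass F) l n m k x1 x2 xb xt :
  line_meets W l n x1 x2 xb -> line_meets W m k x2 x2 xt ->
  l * x2 + n = m * x2 + k -> x1 != x2 ->
  exists w, [/\ a3 W = w * (x1 - x2) - 2 * (l * x2 + n) - a1 W * x2,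
    xb = x2 + w * (m - l),
    a2 W = l ^+ 2 + a1 W * l - (x1 + x2 + xb),
    a4 W = x2 * x2 + x2 * xt + x2 * xt + a1 W * k + a3 W * m + 2 * m * k &
    xt = m ^+ 2 + a1 W * m - a2 W - x2 - x2].
Proof.
case=> e1 e2 e3 [f1 f2 f3] ey ne.
have d0 : x1 - x2 != 0 by rewrite subr_eq0.
have ea2 : a2 W = l ^+ 2 + a1 W * l - (x1 + x2 + xb) by rewrite e1; ring.
have ext : xt = m ^+ 2 + a1 W * m - a2 W - x2 - x2 by rewrite -f1; ring.
have ea4 : a4 W = x2 * x2 + x2 * xt + x2 * xt + a1 W * k + a3 W * m + 2 * m * k.
  by rewrite f2; ring.
set u := 2 * (l * x2 + n) + a1 W * x2 + a3 W.
exists (u / (x1 - x2)); split=> //.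
  by rewrite divfK // /u; ring.
apply: (mulfI d0); rewrite mulrDr mulrA mulrCA divff // mulr1.
have ek : k = l * x2 + n - m * x2 by rewrite ey; ring.
rewrite ea4 ext ea2 ek in e2.
apply/eqP; rewrite -subr_eq0; apply/eqP; move/eqP: e2; rewrite -subr_eq0 => /eqP e2.
by rewrite -[RHS]e2 /u; ring.
Qed.

(** The generic case of (P + A) + A = P + (A + A), where x1, x2, xb, xt are the abscissae of P, A, P
    + A, A + A. The inequalities make both outer sums chords. *)
Lemma ec_addA_chord_tangent (F : fieldType) (W : weierstrass F) l n m k x1 x2 xb xt :
  line_meets W l n x1 x2 xb -> line_meets W m k x2 x2 xt ->
  l * x2 + n = m * x2 + k -> x1 != x2 -> xb != x2 -> xt != x1 ->
  ec_add W (ec_opp W (Some (xb, l * xb + n))) (Some (x2, l * x2 + n)) =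
  ec_add W (Some (x1, l * x1 + n)) (ec_opp W (Some (xt, m * xt + k))).
Proof.
move=> L T ey ne1 neb net.
have [w [e3 eb e2 _ et]] := chord_tangent L T ey ne1.
rewrite /ec_opp ec_add_chord // ec_add_chord 1?eq_sym //.
have ek : k = l * x2 + n - m * x2 by rewrite ey; ring.
have en : n = (l * x2 + n) - l * x2 by ring.
move: (l * x2 + n) en ek e3 {ey L T} => y2 -> -> e3.
move: neb net; rewrite et e3 e2 eb eq_sym -subr_eq0 => neb; rewrite -subr_eq0 => net.
by congr (Some (_, _)); field; rewrite net.
Qed.

(** The case P = A + A, where the right-hand sum is a tangent. Comparing ordinates at x1 gives one
    further relation, [el], which eliminates l. *)
Lemma ec_addA_triple (F : fieldType) (W : weierstrass F) l n m k x1 x2 xb :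
  line_meets W l n x1 x2 xb -> line_meets W m k x2 x2 x1 ->
  l * x2 + n = m * x2 + k -> x1 != x2 -> xb != x2 ->
  Some (x1, l * x1 + n) = ec_opp W (Some (x1, m * x1 + k)) ->
  2 * (l * x1 + n) + a1 W * x1 + a3 W != 0 ->
  ec_add W (ec_opp W (Some (xb, l * xb + n))) (Some (x2, l * x2 + n)) =
  ec_add W (Some (x1, l * x1 + n)) (Some (x1, l * x1 + n)).
Proof.
move=> L T ey ne1 neb [eopp] u0.
have [w [e3 eb _ e4 et]] := chord_tangent L T ey ne1.
have d0 : x1 - x2 != 0 by rewrite subr_eq0.
have ek : k = l * x2 + n - m * x2 by rewrite ey; ring.
have en : n = (l * x2 + n) - l * x2 by ring.
have el : l = - w - m - a1 W.
  apply: (mulfI d0); apply/eqP; rewrite -subr_eq0; apply/eqP.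
  move/eqP: eopp; rewrite -subr_eq0 => /eqP eopp.
  by rewrite -[RHS]eopp ek e3; ring.
have e2 : a2 W = m ^+ 2 + a1 W * m - x2 - x2 - x1 by rewrite [in RHS]et; ring.
rewrite /ec_opp ec_add_chord // ec_add_tangent //.
move: (l * x2 + n) en ek e3 {ey L T eopp et} => y2 en ek e3.
move: neb u0; rewrite e4 ek e3 e2 eb en el eq_sym -subr_eq0 => neb u0.
by congr (Some (_, _)); field; rewrite u0.
Qed.

Lemma ec_same_x (F : fieldType) (W : weierstrass F) (x y1 y2 : F) :
  ec_points W (Some (x, y1)) -> ec_points W (Some (x, y2)) ->
  Some (x, y1) = Some (x, y2) \/ Some (x, y1) = ec_opp W (Some (x, y2)).
Proof.
move=> E1 E2; have [->|u0] := ec_eq_or_opp E1 E2; first by left.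
by right; congr (Some (_, _)); rewrite -[LHS]subr0 -u0; ring.
Qed.

(* The only instance of associativity that doubling needs. Apart from P = A + A
   every degenerate case follows from the cancellation law [ec_addNK]. *)
Lemma ec_addAA (F : fieldType) (W : weierstrass F) P A :
  discriminant W != 0 -> ec_points W P -> ec_points W A ->
  ec_add W (ec_add W P A) A = ec_add W P (ec_add W A A).
Proof.
move=> D0 EP EA.
have NA := ec_opp_point EA; have AA := ec_add_point EA EA.
have PA := ec_add_point EP EA.
have K X Y : ec_points W X -> ec_points W Y ->
    ec_add W X (ec_add W (ec_opp W X) Y) = Y.
  by move=> EX EY; rewrite -{1}[X](ec_oppK W) ec_addNK //; apply: ec_opp_point.
have [A2|A2] := eqVneq A (ec_opp W A).
  rewrite {4}A2 ec_addN ec_addP0 ec_addC // (ec_addC D0 EP EA).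
  by rewrite {1}A2 ec_addNK.
have [->|P0] := eqVneq P None; first by [].
have [->|A0] := eqVneq A None; first by rewrite !ec_addP0.
have [->|PNA] := eqVneq P (ec_opp W A); first by rewrite ec_addNl ec_addNK.
have [->|PneA] := eqVneq P A; first by rewrite ec_addC.
have [e|PAA] := eqVneq (ec_add W P A) A.
  rewrite ec_addC // in e.
  by rewrite (ec_add_eqE D0 EA EP e) ec_addNl eqxx in P0.
have [e|PANA] := eqVneq (ec_add W P A) (ec_opp W A).
  rewrite e ec_addNl; rewrite ec_addC // in e.
  by rewrite (ec_add_eqE D0 EA EP e) ec_oppD // ec_addNl.
(* Otherwise P = (-A) + (-A), and cancellation gives P + A = -A, which is excluded. *)
have PN2A : ec_add W A A != ec_opp W P.
  apply: contraNneq PANA => e.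
  rewrite -(ec_oppK W P) -e -ec_oppD // ec_addC ?K //.
  exact: ec_add_point.
case: P A EP EA NA AA PA P0 A0 A2 PNA PneA PAA PANA PN2A =>
  [[x1 y1]|//] [[x2 y2]|//] EP EA NA AA PA _ _ A2 PNA PneA PAA PANA PN2A.
have ne1 : x1 != x2.
  apply/eqP => e; subst x2.
  by have [e|e] := ec_same_x EP EA; rewrite e eqxx in PNA PneA.
case eB: (ec_opp W (ec_add W (Some (x1, y1)) (Some (x2, y2)))) => [[xb yb]|]; last first.
  have {}e : ec_add W (Some (x1, y1)) (Some (x2, y2)) = None.
    by rewrite -[LHS](ec_oppK W) eB.
  by rewrite (ec_add_eq0 EP EA e) ec_oppK eqxx in PNA.
case eT: (ec_opp W (ec_add W (Some (x2, y2)) (Some (x2, y2)))) => [[xt yt]|]; last first.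
  have {}e : ec_add W (Some (x2, y2)) (Some (x2, y2)) = None.
    by rewrite -[LHS](ec_oppK W) eT.
  by rewrite {1}(ec_add_eq0 EA EA e) eqxx in A2.
have EB := ec_opp_point PA; rewrite eB in EB.
have ET := ec_opp_point AA; rewrite eT in ET.
have {}eB : ec_add W (Some (x1, y1)) (Some (x2, y2)) = ec_opp W (Some (xb, yb)).
  by rewrite -eB ec_oppK.
have {}eT : ec_add W (Some (x2, y2)) (Some (x2, y2)) = ec_opp W (Some (xt, yt)).
  by rewrite -eT ec_oppK.
have neb : xb != x2.
  apply/eqP => e; subst xb.
  by have [e|e] := ec_same_x EB EA; rewrite eB e ?ec_oppK eqxx in PAA PANA.
have [l [n [ey1 ey2 eyb L]]] := ec_add_line EP EA eB.
have [m [k [ey2' _ eyt T]]] := ec_add_line EA EA eT.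
have eyy : l * x2 + n = m * x2 + k by rewrite -ey2.
rewrite eB.
have [ext|net] := eqVneq xt x1; last first.
  by rewrite eT ey2 ey1 eyb eyt (ec_addA_chord_tangent L T).
(* The third point on the tangent at A is now P or -P. The former means A + A = -P, excluded by
   [PN2A]. In the latter A + A = P, and P cannot equal -P for the same reason. *)
subst xt; have [e|e] := ec_same_x EP ET; last first.
  rewrite eT -e.
  have [u0|u0] := eqVneq (2 * y1 + a1 W * x1 + a3 W) 0; last first.
    have := ec_addA_triple L T eyy ne1 neb.
    by rewrite -ey1 -ey2 -eyb -eyt => /(_ e u0).
  have P2 : Some (x1, y1) = ec_opp W (Some (x1, y1)).
    by congr (Some (_, _)); rewrite -[LHS]subr0 -u0; ring.
  by rewrite eT -e -P2 eqxx in PN2A.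
by rewrite eT e eqxx in PN2A.
Qed.

Lemma ec_muln_point (F : fieldType) (W : weierstrass F) n P :
  ec_points W P -> ec_points W (ec_muln W n P).
Proof. by move=> EP; elim: n => //= n IH; apply: ec_add_point. Qed.

(* With B = (n+1)P: since -P + B = nP, the point nP + B equals -P + 2B by
   [ec_addAA], while it also equals P + 2nP. *)
Lemma ec_muln_double (F : fieldType) (W : weierstrass F) n P :
  discriminant W != 0 -> ec_points W P ->
  ec_muln W (n + n) P = ec_add W (ec_muln W n P) (ec_muln W n P).
Proof.
move=> D0 EP; elim: n => // n IH.
rewrite addSn addnS; set A := ec_muln W n P in IH *.
have EA : ec_points W A by exact: ec_muln_point.
have -> : ec_muln W n.+1 P = ec_add W P A by [].
set B := ec_add W P A; have EB : ec_points W B by exact: ec_add_point.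
have -> : ec_muln W (n + n).+2 P = ec_add W P (ec_add W P (ec_add W A A)).
  by rewrite -IH.
rewrite -ec_addAA // -/B.
have := ec_addAA D0 (ec_opp_point EP) EB.
rewrite {1}/B ec_addNK // ec_addC // => ->.
rewrite -{1}[P](ec_oppK W) ec_addNK //; first exact: ec_opp_point.
exact: ec_add_point.
Qed.

(** * The height of a double *)

(** The quantities bound by [let] inside [discriminant]; here they serve as coefficients of the
    duplication forms. *)
Definition b2 (A : comNzRingType) (W : weierstrass A) : A := a1 W ^+ 2 + 4 * a2 W.
Definition b4 (A : comNzRingType) (W : weierstrass A) : A := 2 * a4 W + a1 W * a3 W.
Definition b6 (A : comNzRingType) (W : weierstrass A) : A := a3 W ^+ 2 + 4 * a6 W.
Definition b8 (A : comNzRingType) (W : weierstrass A) : A :=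
  a1 W ^+ 2 * a6 W + 4 * a2 W * a6 W - a1 W * a3 W * a4 W
  + a2 W * a3 W ^+ 2 - a4 W ^+ 2.

(* The duplication formula is x(2P) = dup_num x 1 / dup_den x 1. *)
Definition dup_num (A : comNzRingType) (W : weierstrass A) (p q : A) : A :=
  p ^+ 4 - b4 W * p ^+ 2 * q ^+ 2 - 2 * b6 W * p * q ^+ 3 - b8 W * q ^+ 4.
Definition dup_den (A : comNzRingType) (W : weierstrass A) (p q : A) : A :=
  4 * p ^+ 3 * q + b2 W * p ^+ 2 * q ^+ 2 + 2 * b4 W * p * q ^+ 3 + b6 W * q ^+ 4.

(** An elimination identity for the two duplication forms. It limits both their common divisors and
    how small they can be simultaneously. *)
Lemma dup_bezout (A : comNzRingType) (W : weierstrass A) (p q : A) :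
  q * (- 48 * p ^+ 2 - 8 * b2 W * p * q + (b2 W ^+ 2 - 32 * b4 W) * q ^+ 2)
    * dup_num W p q +
  (12 * p ^+ 3 - b2 W * p ^+ 2 * q - 10 * b4 W * p * q ^+ 2 +
    (b2 W * b4 W - 27 * b6 W) * q ^+ 3) * dup_den W p q =
  discriminant W * q ^+ 7.
Proof. by rewrite /dup_num /dup_den /discriminant /b2 /b4 /b6 /b8; ring. Qed.

(** On the curve the denominator is the square of u = 2 y + a1 x + a3, which vanishes exactly when
    the point is its own opposite. *)
Lemma ec_double_x (F : fieldType) (W : weierstrass F) (x y : F) :
  ec_points W (Some (x, y)) ->
  match ec_add W (Some (x, y)) (Some (x, y)) with
  | None => dup_den W x 1 = 0
  | Some (x', _) => dup_den W x 1 != 0 /\ x' * dup_den W x 1 = dup_num W x 1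
  end.
Proof.
move=> E; set u := 2 * y + a1 W * x + a3 W.
have D : dup_den W x 1 = u ^+ 2.
  rewrite /dup_den /b2 /b4 /b6 /u.
  have -> : a6 W = y ^+ 2 + a1 W * x * y + a3 W * y - (x ^+ 3 + a2 W * x ^+ 2 + a4 W * x).
    by move: E => /= ->; ring.
  ring.
have [u0|u0] := eqVneq u 0.
  rewrite /ec_add eqxx /=.
  have -> : y + y + a1 W * x + a3 W = u by rewrite /u; ring.
  by rewrite D u0 eqxx expr0n.
rewrite ec_add_tangent // -/u D; split; first by rewrite expf_neq0.
set v := 3 * x ^+ 2 + 2 * a2 W * x + a4 W - a1 W * y.
have -> : ((v / u) ^+ 2 + a1 W * (v / u) - a2 W - x - x) * u ^+ 2 =
          v ^+ 2 + a1 W * v * u - (a2 W + 2 * x) * u ^+ 2 by field.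
rewrite /dup_num /b4 /b6 /b8 /u /v.
have -> : a6 W = y ^+ 2 + a1 W * x * y + a3 W * y - (x ^+ 3 + a2 W * x ^+ 2 + a4 W * x).
  by move: E => /= ->; ring.
ring.
Qed.

Lemma dup_num_rat (E : weierstrass int) (p q : int) : q != 0 ->
  dup_num (over_rat E) (p%:~R / q%:~R) 1 * q%:~R ^+ 4 = (dup_num E p q)%:~R.
Proof.
move=> q0; have q0' : q%:~R != 0 :> rat by rewrite intr_eq0.
rewrite /dup_num /b4 /b6 /b8 /over_rat /=.
by rewrite !(rmorphB, rmorphD, rmorphM, rmorphXn) /=; field.
Qed.

Lemma dup_den_rat (E : weierstrass int) (p q : int) : q != 0 ->
  dup_den (over_rat E) (p%:~R / q%:~R) 1 * q%:~R ^+ 4 = (dup_den E p q)%:~R.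
Proof.
move=> q0; have q0' : q%:~R != 0 :> rat by rewrite intr_eq0.
rewrite /dup_den /b2 /b4 /b6 /over_rat /=.
by rewrite !(rmorphB, rmorphD, rmorphM, rmorphXn) /=; field.
Qed.

(** Modulo q the form [dup_num] is p ^ 4, so d is coprime to q, and [dup_bezout] leaves only the
    discriminant. *)
Lemma dup_gcd (E : weierstrass int) (p q d : int) : coprimez p q ->
  (d %| dup_num E p q)%Z -> (d %| dup_den E p q)%Z -> (d %| discriminant E)%Z.
Proof.
move=> cpq dF dG.
have cFq : coprimez (dup_num E p q) q.
  have -> : dup_num E p q =
     (- b4 E * p ^+ 2 * q - 2 * b6 E * p * q ^+ 2 - b8 E * q ^+ 3) * q + p ^+ 4.
    by rewrite /dup_num; ring.
  by rewrite coprimez_sym /coprimez gcdzMDl; apply: coprimezXr; rewrite coprimez_sym.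
have cdq : coprimez d (q ^+ 7) by apply: coprimezXr; apply: coprimez_dvdl dF cFq.
by rewrite -(Gauss_dvdzl _ cdq) -(dup_bezout E p q) rpredD // dvdz_mull.
Qed.

Lemma norm_monomial_le (R : realDomainType) (a p q M : R) (i j k : nat) :
  (i + j)%N = k -> `|p| <= M -> `|q| <= M ->
  `|a * p ^+ i * q ^+ j| <= `|a| * M ^+ k.
Proof.
move=> <- hp hq; rewrite -mulrA !normrM !normrX exprD.
by rewrite ler_wpM2l // ler_pM ?exprn_ge0 // lerXn2r ?nnegrE // (le_trans _ hp).
Qed.

Lemma ler_norm4 (R : realDomainType) (a b c d A B C D : R) :
  `|a| <= A -> `|b| <= B -> `|c| <= C -> `|d| <= D -> `|a + b + c + d| <= A + B + C + D.
Proof.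
move=> ha hb hc hd.
by do 3!(apply: le_trans (ler_normD _ _) _; apply: lerD => //).
Qed.

Lemma ler_norm4M (R : realDomainType) (a b c d A B C D M : R) :
  `|a| <= A * M -> `|b| <= B * M -> `|c| <= C * M -> `|d| <= D * M ->
  `|a + b + c + d| <= (A + B + C + D) * M.
Proof. by rewrite !mulrDl; apply: ler_norm4. Qed.

(** Both forms have degree 4, so the sums of the absolute values of their coefficients bound them;
    the added 1 makes K positive. *)
Lemma dup_upper (E : weierstrass int) : exists2 K : int, 0 < K &
  forall p q M : int, `|p| <= M -> `|q| <= M ->
    `|dup_num E p q| <= K * M ^+ 4 /\ `|dup_den E p q| <= K * M ^+ 4.
Proof.
pose s1 := `|1| + `|- b4 E| + `|- 2 * b6 E| + `|- b8 E|.
pose s2 := `|4| + `|b2 E| + `|2 * b4 E| + `|b6 E|.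
have s1_ge0 : 0 <= s1 by rewrite !addr_ge0.
have s2_ge0 : 0 <= s2 by rewrite !addr_ge0.
exists (1 + s1 + s2); first by rewrite -addrA ltr_pwDl // addr_ge0.
move=> p q M hp hq.
have B a i j (e : (i + j)%N = 4) := norm_monomial_le a e hp hq.
have M0 : 0 <= M ^+ 4 by rewrite exprn_ge0 // (le_trans _ hp).
split.
  have -> : dup_num E p q = 1 * p ^+ 4 * q ^+ 0 + - b4 E * p ^+ 2 * q ^+ 2 +
    (- 2 * b6 E) * p ^+ 1 * q ^+ 3 + - b8 E * p ^+ 0 * q ^+ 4.
    by rewrite /dup_num; ring.
  apply: (@le_trans _ _ (s1 * M ^+ 4)); first by apply: ler_norm4M; apply: B.
  by rewrite ler_wpM2r // addrAC lerDr addr_ge0.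
have -> : dup_den E p q = 4 * p ^+ 3 * q ^+ 1 + b2 E * p ^+ 2 * q ^+ 2 +
  (2 * b4 E) * p ^+ 1 * q ^+ 3 + b6 E * p ^+ 0 * q ^+ 4.
  by rewrite /dup_den; ring.
apply: (@le_trans _ _ (s2 * M ^+ 4)); first by apply: ler_norm4M; apply: B.
by rewrite ler_wpM2r // lerDr addr_ge0.
Qed.

(* If |p| is large compared to |q| then p ^+ 4 dominates dup_num; otherwise
   [dup_bezout] bounds q ^+ 7. *)
Lemma dup_lower (E : weierstrass int) : discriminant E != 0 ->
  exists2 K : int, 0 < K & forall p q m : int, q != 0 ->
    `|dup_num E p q| <= m -> `|dup_den E p q| <= m ->
    `|p| ^+ 4 <= K * m /\ `|q| ^+ 4 <= K * m.
Proof.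
move=> D0.
pose S := `|b4 E| + `|2 * b6 E| + `|b8 E|.
(* Once |p| >= T |q|, the terms of [dup_num] other than p ^ 4 amount to at most half of |p| ^ 4. *)
pose T := 2 * (1 + S).
(* [L1] and [L2] are the coefficient sums of the two cofactors in [dup_bezout]; the 0 pads to the
   four terms of [ler_norm4M]. *)
pose L1 := `|- 48| + `|- 8 * b2 E| + `|b2 E ^+ 2 - 32 * b4 E| + `|0 : int|.
pose L2 := `|12| + `|- b2 E| + `|- 10 * b4 E| + `|b2 E * b4 E - 27 * b6 E|.
have S0 : 0 <= S by rewrite !addr_ge0.
have T1 : 1 <= T by rewrite /T; lra.
have L0 : 0 <= L1 + L2 by rewrite !addr_ge0.
exists (2 + (L1 + L2) * T ^+ 7).
  by rewrite ltr_pwDl // mulr_ge0 // exprn_ge0 // (le_trans _ T1).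
move=> p q m q0 hF hG.
have m0 : 0 <= m by apply: le_trans hF.
have v0 : 0 < `|q| by rewrite normr_gt0.
have KL : 0 <= (L1 + L2) * T ^+ 7 * m.
  by rewrite !mulr_ge0 // exprn_ge0 // (le_trans _ T1).
have [le|/ltW le] := leP (T * `|q|) `|p|.
  have vu : `|q| <= `|p| by apply: le_trans le; rewrite ler_peMl // ltW.
  have h : `|p| ^+ 4 <= 2 * m.
    set z := `|p| ^+ 3 * `|q|.
    have : `|p| ^+ 4 <= m + S * z.
      have -> : `|p| ^+ 4 = `|dup_num E p q + b4 E * p ^+ 2 * q ^+ 2 +
          2 * b6 E * p ^+ 1 * q ^+ 3 + b8 E * p ^+ 0 * q ^+ 4|.
        by rewrite -normrX; congr `|_|; rewrite /dup_num; ring.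
      have -> : m + S * z = m + `|b4 E| * z + `|2 * b6 E| * z + `|b8 E| * z.
        by rewrite /S; ring.
      have B (a : int) (i j : nat) : (i + j = 3)%N ->
          `|a * p ^+ i * q ^+ j.+1| <= `|a| * z.
        move=> ij; rewrite /z; rewrite -mulrA !normrM !normrX exprSr.
        rewrite ler_wpM2l // mulrA ler_wpM2r // -ij exprD ler_wpM2l ?exprn_ge0 //.
        by rewrite lerXn2r ?nnegrE.
      by apply: ler_norm4 => //; apply: B.
    have : 2 * (S * z) <= `|p| ^+ 4.
      have -> : 2 * (S * z) = `|p| ^+ 3 * (2 * S * `|q|) by rewrite /z; ring.
      rewrite [X in _ <= X]exprSr ler_wpM2l ?exprn_ge0 //.
      apply: le_trans le; rewrite ler_wpM2r // /T; lra.
    by lra.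
  rewrite mulrDl; split; first by rewrite (le_trans h) // lerDl.
  by rewrite (le_trans (lerXn2r 4 _ _ vu)) ?nnegrE // (le_trans h) // lerDl.
have vM : `|q| <= T * `|q| by rewrite ler_peMl // ltW.
(* The discriminant is a nonzero integer, so |q| ^ 7 is at most the right-hand side of [dup_bezout];
   the cubic cofactors are at most a multiple of (T |q|) ^ 3, and |q| ^ 3 cancels. *)
have h : `|q| ^+ 4 <= (L1 + L2) * T ^+ 3 * m.
  have v3 : 0 < `|q| ^+ 3 by rewrite exprn_gt0.
  rewrite -(ler_pM2l v3) -exprD.
  apply: (@le_trans _ _ `|discriminant E * q ^+ 7|).
    rewrite normrM normrX ler_peMl ?exprn_ge0 // -gtz0_ge1 normr_gt0 //.
  rewrite -(dup_bezout E p q).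
  have B a i j (e : (i + j)%N = 3) := norm_monomial_le a e le vM.
  have -> : `|q| ^+ 3 * ((L1 + L2) * T ^+ 3 * m) =
      L1 * (T * `|q|) ^+ 3 * m + L2 * (T * `|q|) ^+ 3 * m by ring.
  apply: le_trans (ler_normD _ _) _; rewrite (normrM (_ * _) (dup_num _ _ _)) (normrM _ (dup_den _ _ _)).
  apply: lerD; apply: ler_pM => //.
    have -> : q * (- 48 * p ^+ 2 - 8 * b2 E * p * q + (b2 E ^+ 2 - 32 * b4 E) * q ^+ 2) =
     - 48 * p ^+ 2 * q ^+ 1 + - 8 * b2 E * p ^+ 1 * q ^+ 2 +
     (b2 E ^+ 2 - 32 * b4 E) * p ^+ 0 * q ^+ 3 + 0 * p ^+ 3 * q ^+ 0 by ring.
    by rewrite /L1; apply: ler_norm4M; apply: B.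
  have -> : 12 * p ^+ 3 - b2 E * p ^+ 2 * q - 10 * b4 E * p * q ^+ 2 +
      (b2 E * b4 E - 27 * b6 E) * q ^+ 3 =
     12 * p ^+ 3 * q ^+ 0 + - b2 E * p ^+ 2 * q ^+ 1 + - 10 * b4 E * p ^+ 1 * q ^+ 2 +
      (b2 E * b4 E - 27 * b6 E) * p ^+ 0 * q ^+ 3 by ring.
  by rewrite /L2; apply: ler_norm4M; apply: B.
have h' : (T * `|q|) ^+ 4 <= (2 + (L1 + L2) * T ^+ 7) * m.
  rewrite exprMn; apply: (@le_trans _ _ (T ^+ 4 * ((L1 + L2) * T ^+ 3 * m))).
    by rewrite ler_wpM2l // exprn_ge0 // (le_trans _ T1).
  have -> : T ^+ 4 * ((L1 + L2) * T ^+ 3 * m) = (L1 + L2) * T ^+ 7 * m by ring.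
  by rewrite [X in _ <= X]mulrDl lerDr mulr_ge0.
split; apply: le_trans h'; rewrite lerXn2r ?nnegrE //.
Qed.

(** * Heights of rational points and Tate's limit *)

(** The exponential of the naive height, kept in [nat] for divisibility arguments. *)
Definition mul_height (P : ec_point rat) : nat :=
  match P with
  | None => 1
  | Some (x, _) => maxn `|numq x| `|denq x|
  end.

Lemma mul_height_gt0 P : (0 < mul_height P)%N.
Proof. by case: P => [[x y]|] //=; rewrite leq_max !absz_gt0 denq_neq0 orbT. Qed.

Lemma naive_heightE (R : realType) P : naive_height R P = ln (mul_height P)%:R.
Proof. by case: P => [[x y]|] //=; rewrite ln1. Qed.

(** Here g is the factor cancelled when the duplication fraction is put in lowest terms; it divides
    both forms, hence the discriminant by [dup_gcd]. *)
Lemma double_height_gcd (E : weierstrass int) (x y : rat) :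
  ec_points (over_rat E) (Some (x, y)) ->
  exists2 g : nat, (g %| `|discriminant E|)%N &
    maxn `|dup_num E (numq x) (denq x)| `|dup_den E (numq x) (denq x)| =
    (g * mul_height (ec_add (over_rat E) (Some (x, y)) (Some (x, y))))%N.
Proof.
move=> EP; have := ec_double_x EP.
have q0 : denq x != 0 by exact: denq_neq0.
have q0' : (denq x)%:~R ^+ 4 != 0 :> rat by rewrite expf_neq0 // intr_eq0.
have := dup_num_rat E (numq x) q0; have := dup_den_rat E (numq x) q0.
rewrite divq_num_den; set F := dup_num E _ _; set G := dup_den E _ _.
have gcd d : (d %| F)%Z -> (d %| G)%Z -> (d %| discriminant E)%Z.
  by apply: dup_gcd; rewrite coprimezE coprime_num_den.
case: (ec_add _ _ _) => [[x' y']|] hG hF /=.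
  case=> G0 e.
  have eFG : numq x' * G = F * denq x'.
    apply: (@intr_inj rat); rewrite !rmorphM /= numqE -hG -hF -e; ring.
  have /dvdzP[g eg] : (denq x' %| G)%Z.
    rewrite -(@Gauss_dvdzr _ (numq x')) ?eFG ?dvdz_mull //.
    by rewrite coprimez_sym coprimezE coprime_num_den.
  have ef : F = g * numq x'.
    apply: (mulIf (denq_neq0 x')); rewrite -eFG eg; ring.
  exists `|g|%N.
    by rewrite -dvdzE gcd // ?eg ?ef dvdz_mulr.
  by rewrite ef eg !abszM maxnMr.
(* The double is the point at infinity, of height 1. The denominator form is 0, so F divides both
   forms and serves as g. *)
move=> G0; exists `|F|%N.
  rewrite -dvdzE gcd //.
  have -> : G = 0 by apply: (@intr_inj rat); rewrite -hG G0 mul0r.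
  exact: dvdz0.
have -> : G = 0 by apply: (@intr_inj rat); rewrite -hG G0 mul0r.
by rewrite maxn0 muln1.
Qed.

Lemma PoszX4 (n : nat) : n%:Z ^+ 4 = (n ^ 4)%N%:Z.
Proof. by rewrite !expnS expn0 !PoszM !exprS expr0. Qed.

(** The larger of the two forms is the height of the double up to a factor of at most
    |discriminant|. [dup_upper] and [dup_lower] compare it with the fourth power of the height. *)
Lemma double_height (E : weierstrass int) : discriminant E != 0 ->
  exists2 C : nat, (0 < C)%N & forall P, ec_points (over_rat E) P ->
    let P2 := ec_add (over_rat E) P P in
    (mul_height P2 <= C * mul_height P ^ 4)%N /\
    (mul_height P ^ 4 <= C * mul_height P2)%N.
Proof.
move=> D0; have [[k1|//] k1_gt0 up] := dup_upper E.
have [[k2|//] k2_gt0 low] := dup_lower D0.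
rewrite ltz_nat in k1_gt0.
exists (k1 + k2 * `|discriminant E|)%N; first by rewrite addn_gt0 k1_gt0.
case=> [[x y]|] EP P2; last by rewrite /= exp1n muln1 addn_gt0 k1_gt0.
have [g gD eg] := double_height_gcd EP; rewrite -/P2 in eg.
have g_gt0 : (0 < g)%N by rewrite (dvdn_gt0 _ gD) // absz_gt0.
have g_le : (g <= `|discriminant E|)%N by rewrite dvdn_leq // absz_gt0.
rewrite [mul_height (Some _)]/=.
have q0 := denq_neq0 x.
move: (numq x) (denq x) eg q0 => p q eg q0.
have hP : (0 < mul_height P2)%N by exact: mul_height_gt0.
move: (mul_height P2) eg hP => h eg hP.
set M := maxn `|p| `|q|.
have [||uF uG] := up p q M; try by rewrite -abszE lez_nat ?leq_maxl ?leq_maxr.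
have [||lp lq] := low p q (g * h)%N q0; try by rewrite -abszE lez_nat -eg ?leq_maxl ?leq_maxr.
move: uF uG lp lq; rewrite -!abszE !PoszX4 -!PoszM !lez_nat => uF uG lp lq.
split.
  apply: leq_trans (leq_pmull h g_gt0) _; rewrite -eg geq_max.
  by rewrite !(leq_trans _ (leq_mul (leq_addr _ k1) (leqnn _))).
apply: (@leq_trans (k2 * (g * h))); last first.
  by rewrite mulnDl mulnA (leq_trans _ (leq_addl _ _)) // leq_mul // leq_mul.
by rewrite /M /maxn; case: ifP.
Qed.

(* h n / 4 ^+ n + (K / 3) / 4 ^+ n is nonincreasing and
   h n / 4 ^+ n - (K / 3) / 4 ^+ n is nondecreasing. *)
Lemma tate_limit (R : realType) (h : nat -> R) (K : R) :
  (forall n, 0 <= h n) -> (forall n, `|h n.+1 - 4 * h n| <= K) ->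
  0 <= limn (fun n => h n / 4 ^+ n) /\ h 0%N - K / 3 <= limn (fun n => h n / 4 ^+ n).
Proof.
move=> h0 hK; pose u n := h n / 4 ^+ n; pose g := geometric (K / 3) (4^-1 : R).
have K0 : 0 <= K by apply: le_trans (hK 0%N).
have p4 n : 0 < (4 : R) ^+ n by rewrite exprn_gt0.
have gE n : g n = K / 3 / 4 ^+ n by rewrite /g /= exprVn.
have g0 n : 0 <= g n by rewrite gE !divr_ge0 // ltW.
have u0 n : 0 <= u n by rewrite divr_ge0 // ltW.
have step n : u n - g n <= u n.+1 - g n.+1 /\ u n.+1 + g n.+1 <= u n + g n.
  have := hK n; rewrite ler_norml => /andP[h1 h2].
  have e : (4 : R) ^+ n.+1 = 4 * 4 ^+ n by rewrite exprS.
  have q0 : (4 : R) ^+ n != 0 by rewrite gt_eqF.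
  have -> : u n - g n = (4 * h n - 4 * (K / 3)) / 4 ^+ n.+1.
    by rewrite /u gE e; field.
  have -> : u n + g n = (4 * h n + 4 * (K / 3)) / 4 ^+ n.+1.
    by rewrite /u gE e; field.
  rewrite /u gE -mulrBl -mulrDl !ler_pM2r ?invr_gt0 //.
  by split; lra.
have low n : u 0%N - g 0%N <= u n - g n.
  by elim: n => // n /le_trans -> //; case: (step n).
have cg : g n @[n --> \oo] --> 0.
  by apply: cvg_geometric; rewrite ger0_norm ?invr_ge0 // invf_lt1 // ltr1n.
(* This sum is nonincreasing and nonnegative. Since g tends to 0, u converges too, so its [limn] is
   a genuine limit. *)
have cug : cvgn (u \+ g).
  apply: nonincreasing_is_cvgn.
    by apply: (homo_leq (r := fun x y : R => y <= x)) => // [x y z|n];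
      [move=> a b; exact: le_trans b a | case: (step n)].
  by exists 0 => _ [n _ <-]; rewrite /= addr_ge0.
have cu : cvgn u.
  have -> : u = (u \+ g) - g by apply/funext => n /=; rewrite -[RHS]/(u n + g n - g n) addrK.
  by apply: is_cvgB => //; apply/cvg_ex; exists 0.
split; apply: limr_ge => //; near=> n; first exact: u0.
rewrite -/(u n).
have e0 : u 0%N = h 0%N by rewrite /u expr0 divr1.
have eg : g 0%N = K / 3 by rewrite gE expr0 divr1.
by have := low n; rewrite e0 eg; have := g0 n; lra.
Unshelve. all: by end_near.
Qed.

Lemma ln_natX (R : realType) (a k : nat) : (0 < a)%N ->
  ln ((a ^ k)%N%:R : R) = k%:R * ln (a%:R : R).
Proof. by move=> a0; rewrite natrX lnXn ?ltr0n // mulr_natl. Qed.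

Lemma ln_natM (R : realType) (a b : nat) : (0 < a)%N -> (0 < b)%N ->
  ln ((a * b)%N%:R : R) = ln (a%:R : R) + ln (b%:R : R).
Proof. by move=> a0 b0; rewrite natrM lnM ?posrE ?ltr0n. Qed.

Lemma ln_nat_le (R : realType) (a b : nat) : (0 < a)%N -> (a <= b)%N ->
  ln (a%:R : R) <= ln (b%:R : R).
Proof. by move=> a0 ab; rewrite ler_ln ?posrE ?ltr0n ?ler_nat // (leq_trans a0). Qed.

(** The logarithm of [double_height] bounds h(2P) - 4 h(P) by ln C in absolute value; [tate_limit]
    loses a third of that, and the normalization halves it. *)
Lemma canonical_height_lower (R : realType) (E : weierstrass int) :
  discriminant E != 0 ->
  exists C : R, forall P, ec_points (over_rat E) P ->
    0 <= canonical_height R (over_rat E) P /\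
    2^-1 * naive_height R P - C <= canonical_height R (over_rat E) P.
Proof.
move=> D0; have [C C0 hC] := double_height D0.
have D0' : discriminant (over_rat E) != 0.
  have -> : discriminant (over_rat E) = (discriminant E)%:~R.
    by rewrite /discriminant /=
      !(rmorphD, rmorphB, rmorphN, rmorphM, rmorphXn) /=.
  by rewrite intr_eq0.
exists (2^-1 * (ln C%:R / 3)) => P EP.
pose h n := naive_height R (ec_muln (over_rat E) (2 ^ n) P).
have h_ge0 n : 0 <= h n by rewrite /h naive_heightE ln_ge0 // ler1n mul_height_gt0.
have hK n : `|h n.+1 - 4 * h n| <= ln C%:R.
  have EA := ec_muln_point (2 ^ n) EP.
  rewrite /h expnS mul2n -addnn (ec_muln_double _ D0' EP) !naive_heightE.
  have [] := hC _ EA; set A := ec_muln _ _ _.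
  have p1 := mul_height_gt0 A; have p2 := mul_height_gt0 (ec_add (over_rat E) A A).
  have p3 : (0 < mul_height A ^ 4)%N by rewrite expn_gt0 p1.
  move=> /(ln_nat_le R p2) h1 /(ln_nat_le R p3) h2.
  rewrite ln_natM // ln_natX // in h1; rewrite ln_natM // ln_natX // in h2.
  by rewrite ler_norml; apply/andP; split; lra.
have [l0 l1] := tate_limit h_ge0 hK.
have e0 : h 0%N = naive_height R P by rewrite /h expn0 /= ec_addP0.
rewrite /canonical_height; split; first by rewrite mulr_ge0 // invr_ge0.
by rewrite -mulrBr ler_wpM2l ?invr_ge0 // -e0.
Qed.

(** * A Chebyshev bound *)

Definition primorial (n : nat) : nat := \prod_(0 <= p < n.+1 | prime p) p.

(** By Pascal's rule the next central coefficient is a sum of two binomials, each at least the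
    present one. *)
Lemma central_bin_ge (m : nat) : (2 ^ m <= 'C(m.*2, m))%N.
Proof.
elim: m => // m IH; rewrite expnS mul2n -addnn doubleS binS.
apply: leq_add; apply: leq_trans IH _; last exact: leq_bin2l.
by rewrite binS leq_addl.
Qed.

(** The boolean counts as 0 or 1, so that in Legendre's formula only the prime powers up to 2m
    contribute. *)
Lemma divn_double_le (m d : nat) : (0 < d)%N ->
  (m.*2 %/ d <= (m %/ d).*2 + (d <= m.*2))%N.
Proof.
move=> d0; case: (leqP d m.*2) => [le|lt]; last by rewrite divn_small.
rewrite addn1 -ltnS ltn_divLR // -doubleS -doubleMl ltn_double.
exact: ltn_ceil.
Qed.

(** Legendre's formula for (2m)! and m!: each power of p up to 2m adds at most 1 to the valuation,
    larger ones add nothing. *)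
Lemma logn_central_bin (p m : nat) : prime p ->
  (logn p 'C(m.*2, m) <= trunc_log p m.*2)%N.
Proof.
move=> pp; have p1 := prime_gt1 pp.
have m2 : (m <= m.*2)%N by rewrite -addnn leq_addr.
have small k : (m < k)%N -> (m %/ p ^ k = 0)%N.
  by move=> mk; rewrite divn_small // (ltn_trans mk) // ltn_expl.
have : (logn p 'C(m.*2, m) + (logn p m`!).*2 = logn p (m.*2)`!)%N.
  rewrite -(bin_fact m2) -[in (m.*2 - m)%N]addnn addnK -[(logn p m`!).*2]addnn.
  by rewrite !lognM ?muln_gt0 ?fact_gt0 ?bin_gt0.
rewrite !logn_fact // => e.
have e2 : (\sum_(1 <= k < m.+1) m %/ p ^ k = \sum_(1 <= k < m.*2.+1) m %/ p ^ k)%N.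
  rewrite [RHS](@big_cat_nat _ _ _ m.+1) //= [X in (_ + X)%N]big1_seq ?addn0 //.
  by move=> k /andP[_]; rewrite mem_index_iota => /andP[mk _]; apply: small.
have : (logn p 'C(m.*2, m) + (\sum_(1 <= k < m.+1) m %/ p ^ k).*2 <=
        (\sum_(1 <= k < m.+1) m %/ p ^ k).*2 + \sum_(1 <= k < m.*2.+1) (p ^ k <= m.*2))%N.
  rewrite e e2 -[(\sum_(1 <= k < m.*2.+1) _ %/ _).*2%N]mul2n big_distrr /= -big_split /=.
  by apply: leq_sum => k _; rewrite mul2n divn_double_le // expn_gt0 prime_gt0.
rewrite addnC leq_add2l => /leq_trans; apply.
set t := trunc_log p m.*2.
have [m0|m0] := posnP m; first by rewrite m0 big_geq.
have t2 : (t <= m.*2)%N.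
  have : (p ^ t <= m.*2)%N by rewrite trunc_logP // double_gt0.
  by apply: leq_trans; apply: ltnW; apply: ltn_expl.
rewrite (@big_cat_nat _ _ _ t.+1) //= [X in (_ + X)%N]big1_seq ?addn0.
  apply: (@leq_trans (\sum_(1 <= k < t.+1) 1)); first by apply: leq_sum => k _; apply: leq_b1.
  by rewrite sum_nat_const_nat muln1 subn1.
move=> k /andP[_]; rewrite mem_index_iota => /andP[tk _].
apply/eqP; rewrite eqb0 -ltnNge.
by apply: leq_trans (trunc_log_ltn m.*2 p1) _; rewrite leq_exp2l.
Qed.

Lemma nat_sqrt_bounds (n : nat) : exists s, (s * s <= n < s.+1 * s.+1)%N.
Proof.
elim: n => [|n [s /andP[s1 s2]]]; first by exists 0%N.
have [e|ne] := eqVneq n.+1 (s.+1 * s.+1)%N.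
  by exists s.+1; rewrite e leqnn /= ltn_mul.
by exists s; rewrite (leq_trans s1) //= ltn_neqAle ne.
Qed.

(** A prime power in the coefficient is at most 2m, and a prime above s occurs at most once because
    its square exceeds 2m. The exponent s + 1 counts the indices from 0 to s. *)
Lemma central_bin_le (m s : nat) : (0 < m)%N -> (m.*2 < s.+1 * s.+1)%N ->
  ('C(m.*2, m) <= m.*2 ^ s.+1 * primorial m.*2)%N.
Proof.
move=> m0 hs; set n := m.*2 in hs *; set c := 'C(n, m).
have n0 : (0 < n)%N by rewrite double_gt0.
have c0 : (0 < c)%N by rewrite bin_gt0 /n -addnn leq_addr.
have vt p : prime p -> (logn p c <= trunc_log p n)%N by exact: logn_central_bin.
have v0 p : ~~ prime p -> logn p c = 0%N by rewrite lognE => /negbTE ->.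
have e : c = (\prod_(0 <= p < n.+1) p ^ logn p c)%N.
  (* The factorization of c is widened to n + c so that the range contains n; the factors beyond n
     are then 1. *)
  have e : c = (\prod_(0 <= p < (n + c).+1) p ^ logn p c)%N.
    by rewrite -[LHS](partnT c0) (@widen_partn (n + c)) ?leq_addl.
  rewrite {1}e (@big_cat_nat _ _ _ n.+1) ?ltnS ?leq_addr //= [X in (_ * X)%N]big1_seq ?muln1 //.
  move=> p /andP[_]; rewrite mem_index_iota => /andP[np _].
  have [pp|/v0 -> //] := boolP (prime p).
  have := vt p pp; rewrite (_ : trunc_log p n = 0)%N; first by rewrite leqn0 => /eqP ->.
  by apply/eqP; rewrite trunc_log_eq0; apply/orP; right; rewrite -ltnS prednK // prime_gt0.
rewrite {}e; apply: (@leq_trans (\prod_(0 <= p < n.+1)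
    ((if (p < s.+1)%N then n else 1) * (if prime p then p else 1)))).
  apply: leq_prod => p _; have [pp|np] := boolP (prime p); last first.
    by rewrite v0 // expn0 muln1; case: ifP.
  have pt : (p ^ trunc_log p n <= n)%N by rewrite trunc_logP // prime_gt1.
  have pv := leq_pexp2l (prime_gt0 pp) (vt p pp).
  case: ifP => [_|/negbT ps].
    by rewrite (leq_trans pv) // (leq_trans pt) // leq_pmulr // prime_gt0.
  rewrite mul1n /= -[X in (_ <= X)%N]expn1 leq_pexp2l ?prime_gt0 // (leq_trans (vt p pp)) //.
  rewrite -ltnS ltnNge; apply/negP => t2; move: ps; rewrite -leqNgt => ps.
  have : (s.+1 * s.+1 <= n)%N.
    apply: leq_trans pt; apply: (@leq_trans (p ^ 2)); first by rewrite -mulnn leq_mul.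
    by rewrite leq_pexp2l // prime_gt0.
  by rewrite leqNgt hs.
rewrite big_split /= -[X in (_ * X)%N]big_mkcond leq_mul //.
case: (leqP s.+1 n.+1) => [sn|ns]; last first.
  apply: (@leq_trans (\prod_(0 <= p < n.+1) n)).
    by apply: leq_prod => p _; case: ifP.
  by rewrite prod_nat_const_nat subn0 leq_pexp2l // ltnW.
rewrite (@big_cat_nat _ _ _ s.+1) //= [X in (_ * X)%N]big1_seq ?muln1.
  apply: (@leq_trans (\prod_(0 <= p < s.+1) n)).
    by apply: leq_prod => p _; case: ifP.
  by rewrite prod_nat_const_nat subn0.
move=> p /andP[_]; rewrite mem_index_iota => /andP[sp _].
by rewrite ltnNge sp.
Qed.

Lemma primorial_gt0 n : (0 < primorial n)%N.
Proof. by rewrite prodn_cond_gt0 // => p /prime_gt0. Qed.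

Lemma leq_primorial m n : (m <= n)%N -> (primorial m <= primorial n)%N.
Proof.
move=> mn; rewrite /primorial (@big_cat_nat _ _ _ m.+1 0 n.+1) //=.
by rewrite leq_pmulr // prodn_cond_gt0 // => p /prime_gt0.
Qed.

(** * Growth of the primorial *)

(** Compare the two bounds on the central binomial coefficient for m = n / 2 rounded down and s the
    integer square root of 2m, and take logarithms. *)
Lemma ln_primorial_ge (R : realType) (x : R) (n : nat) : 2 <= x ->
  n%:R <= x -> x < n.+1%:R ->
  (x / 2 - 1) * ln 2 - (Num.sqrt x + 1) * ln x <= ln (primorial n)%:R.
Proof.
move=> x2 nx xn; have x0 : 0 < x by lra.
set m := n./2.
have nm : n = (odd n + m.*2)%N by rewrite odd_double_half.
have m2n : (m.*2 <= n)%N by rewrite [X in (_ <= X)%N]nm leq_addl.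
have m2x : m.*2%:R <= x by apply: le_trans nx; rewrite ler_nat.
have xm : x / 2 - 1 <= m%:R.
  have : n.+1%:R <= m%:R * 2 + 2 :> R.
    rewrite -natrM -natrD ler_nat {1}nm muln2 addn2 ltnS.
    by case: odd; rewrite ?add0n ?add1n.
  lra.
have m0 : (0 < m)%N.
  have : (2 < n.+1)%N by rewrite -(ltr_nat R) (le_lt_trans x2).
  by rewrite nm ltnS; case: (m) => //; case: odd.
have [s /andP[s1 s2]] := nat_sqrt_bounds m.*2.
have sx : s%:R <= Num.sqrt x.
  rewrite -(sqr_sqrtr (ltW x0)) in m2x.
  rewrite -(@ler_pXn2r _ 2) ?nnegrE ?sqrtr_ge0 //; apply: le_trans m2x.
  by rewrite -natrX ler_nat -mulnn.
have c0 : (0 < 'C(m.*2, m))%N by rewrite bin_gt0 -addnn leq_addr.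
have lnx : ln (m.*2%:R : R) <= ln x.
  by rewrite ler_ln ?posrE // ltr0n double_gt0.
have lnx0 : 0 <= ln (m.*2%:R : R) by rewrite ln_ge0 // ler1n double_gt0.
have m2 : (0 < 2 ^ m)%N by rewrite expn_gt0.
have := leq_trans (central_bin_ge m) (central_bin_le m0 s2).
move/(ln_nat_le R m2).
rewrite ln_natX // ln_natM ?primorial_gt0 ?expn_gt0 ?double_gt0 ?m0 //.
rewrite ln_natX ?double_gt0 // => h.
have hp := ln_nat_le R (primorial_gt0 m.*2) (leq_primorial m2n).
have l2 : 0 <= ln (2 : R) by rewrite ln_ge0 // ler1n.
have h1 : (x / 2 - 1) * ln 2 <= m%:R * ln 2 by rewrite ler_wpM2r.
have h2 : s.+1%:R * ln (m.*2%:R : R) <= (Num.sqrt x + 1) * ln x.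
  by rewrite -natr1 ler_pM // ?addr_ge0 // lerD2r.
lra.
Qed.

(** Square the inequality 1 + u <= exp u at u = (ln x) / 4. *)
Lemma sqr_ln_le_sqrt (R : realType) (x : R) : 1 <= x -> ln x ^+ 2 <= 16 * Num.sqrt x.
Proof.
move=> x1; have x0 : 0 < x by lra.
have t0 : 0 <= ln x by rewrite ln_ge0.
have -> : Num.sqrt x = expR (ln x / 4) ^+ 2.
  rewrite -expRM_natl -[in LHS](lnK x0).
  have -> : expR (ln x) = expR (ln x / 4 *+ 2) ^+ 2.
    by rewrite -expRM_natl; congr expR; field.
  by rewrite sqrtr_sqr ger0_norm ?expR_ge0 // mulr_natl.
have := expR_ge1Dx (ln x / 4); set e := expR _ => he.
have : (ln x / 4) ^+ 2 <= e ^+ 2.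
  by rewrite lerXn2r ?nnegrE ?divr_ge0 // ?(le_trans _ he) ?addr_ge0 ?divr_ge0 //; lra.
by rewrite expr_div_n; lra.
Qed.

Lemma primorial_growth (R : realType) (A K : R) : 0 <= A -> 0 <= K ->
  exists x0 : R, 2 <= x0 /\ forall (x : R) (n : nat), x0 <= x -> n%:R <= x -> x < n.+1%:R ->
    A * (x / ln x) + K <= ln (primorial n)%:R.
Proof.
move=> A0 K0.
have L0 : 0 < ln (2 : R) by rewrite ln_gt0 // ltr1n.
have L2 : ln (2 : R) < 2 by rewrite ln_sublinear.
(* With z = x / ln x, the error terms (sqrt x) (ln x), ln x and ln 2 are at most 16 z, 16 z and 2 z,
   whence 34. For ln x >= T the main term z (ln x) (ln 2) / 2 exceeds z (A + 34 + K). *)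
pose T := 1 + 2 * (A + 34 + K) / ln 2.
have T1 : 1 <= T by rewrite lerDl divr_ge0 ?mulr_ge0 ?addr_ge0 // ltW.
exists (2 + expR T); split; first by rewrite lerDl expR_ge0.
move=> x n xT nx xn.
have x2 : 2 <= x by apply: le_trans xT; rewrite lerDl expR_ge0.
have x0 : 0 < x by lra.
apply: le_trans (ln_primorial_ge x2 nx xn).
have tT : T <= ln x.
  rewrite -[T]expRK ler_ln ?posrE ?expR_gt0 //.
  by apply: le_trans xT; rewrite lerDr.
have := sqr_ln_le_sqrt (le_trans _ x2); rewrite ler1n => /(_ isT).
have tx := ln_sublinear x0.
have y2 := sqr_sqrtr (ltW x0).
have y0 := sqrtr_ge0 x.
move: (Num.sqrt x) (ln x) y2 y0 tT tx => y t y2 y0 tT tx ht.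
have t0 : 0 < t by lra.
set z := x / t.
have ex : x = z * t by rewrite divfK // gt_eqF.
have z1 : 1 <= z by rewrite ler_pdivlMr // mul1r ltW.
have y1 : 1 <= y.
  by rewrite -(@ler_pXn2r _ 2) ?nnegrE // expr1n y2; lra.
have ty : t * y <= 16 * z.
  rewrite mulrA ler_pdivlMr //.
  have -> : t * y * t = t ^+ 2 * y by ring.
  have -> : 16 * x = 16 * y * y by rewrite -y2; ring.
  by rewrite ler_wpM2r.
have tty : t <= t * y by rewrite ler_peMr // ltW.
have hT : A + 34 + K <= t * ln 2 / 2.
  have : 2 * (A + 34 + K) / ln 2 <= t by rewrite /T in tT; lra.
  by rewrite ler_pdivrMr //; lra.
have hz : z * (A + 34 + K) <= z * (t * ln 2 / 2) by rewrite ler_wpM2l //; lra.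
have Kz : K <= K * z by rewrite ler_peMr.
have e1 : (x / 2 - 1) * ln 2 = z * (t * ln 2 / 2) - ln 2 by rewrite ex; field.
rewrite e1 mulrDl mul1r [y * t]mulrC.
lra.
Qed.

(** * Pseudolinearly dependent points *)

Lemma primorial_dvd (n N : nat) :
  (forall p, prime p -> (p <= n)%N -> (p %| N)%N) -> (primorial n %| N)%N.
Proof.
elim: n => [|n IH] h; first by rewrite /primorial big_mkcond big_nat1 dvd1n.
have {}IH : (primorial n %| N)%N.
  by apply: IH => p pp pn; apply: h => //; apply: leqW.
have -> : primorial n.+1 = (primorial n * (if prime n.+1 then n.+1 else 1))%N.
  by rewrite /primorial big_mkcond big_nat_recr //= -big_mkcond.
case: ifP => pn; last by rewrite muln1.
rewrite Gauss_dvd ?IH ?h //.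
rewrite /primorial big_nat_cond.
apply: (big_ind (fun k => coprime k n.+1)) => [|a b ha hb|q].
- exact: coprime1n.
- by rewrite coprimeMl ha hb.
move=> /andP[/andP[_ qn] pq]; rewrite prime_coprime // dvdn_prime2 //.
by rewrite neq_ltn qn.
Qed.

Lemma intr_Fp_eq0 (p : nat) (m : int) : prime p ->
  (m%:~R == 0 :> 'F_p) = (p%:Z %| m)%Z.
Proof.
move=> pp; rewrite dvdzE absz_nat (dvdn_pcharf (pchar_Fp pp)).
by case: m => n //; rewrite NegzE abszN absz_nat mulrNz oppr_eq0.
Qed.

(** The numerator of x - y over the product of the denominators, before any cancellation. *)
Definition cross (x y : rat) : int := numq x * denq y - numq y * denq x.

Lemma cross_eq0 (x y : rat) : cross x y = 0 -> x = y.
Proof.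
move=> /eqP; rewrite subr_eq0 => /eqP e.
rewrite -[x]divq_num_den -[y]divq_num_den.
apply/eqP; rewrite eqr_div ?intr_eq0 ?denq_neq0 //.
by rewrite -!rmorphM /= e.
Qed.

Lemma absz_cross_le (x y : rat) :
  (`|cross x y| <= 2 * maxn `|numq x| `|denq x| * maxn `|numq y| `|denq y|)%N.
Proof.
rewrite -lez_nat abszE; apply: le_trans (ler_normB _ _) _.
rewrite !normrM -!abszE -!PoszM -PoszD lez_nat mul2n -addnn mulnDl.
by rewrite leq_add // ?[(`|numq y| * _)%N]mulnC leq_mul ?leq_maxl ?leq_maxr.
Qed.

(** Unless p divides [denq x], the common reduction is affine; multiply the equality of abscissae in
    ['F_p] by the two denominators, which are units there. *)
Lemma reduction_eq (p : nat) (R : ec_point rat) (x y : rat) : prime p ->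
  reduction p R = reduction p (Some (x, y)) ->
  (p%:Z %| denq x)%Z \/ exists x' y', R = Some (x', y') /\ (p%:Z %| cross x x')%Z.
Proof.
move=> pp; rewrite [reduction p (Some _)]/reduction; case: ifP => [|dx]; first by left.
case: R => [[x' y']|] //; rewrite /reduction; case: ifP => // dx' e;
  have ex : ratr x' = ratr x :> 'F_p :=
    congr1 (fun P : ec_point 'F_p => if P is Some (a, _) then a else 0) e; right; exists x', y'; split=> //.
have d0 : (denq x)%:~R != 0 :> 'F_p by rewrite intr_Fp_eq0 ?dx.
have d0' : (denq x')%:~R != 0 :> 'F_p by rewrite intr_Fp_eq0 ?dx'.
have num z : (denq z)%:~R != 0 :> 'F_p -> (numq z)%:~R = ratr z * (denq z)%:~R :> 'F_p.
  by move=> z0; rewrite /ratr divfK.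
by rewrite -intr_Fp_eq0 // /cross rmorphB !rmorphM /= !num // ex; apply/eqP; ring.
Qed.

(** Points with the same abscissa are equal or opposite. Hence a point of the curve outside Gamma
    shares its abscissa with no point of Gamma. *)
Lemma same_x_in_subgroup (W : weierstrass rat) (Gamma : set (ec_point rat)) x y y' :
  ec_subgroup W Gamma -> Gamma (Some (x, y')) -> ec_points W (Some (x, y)) ->
  Gamma (Some (x, y)).
Proof.
case=> sub _ _ opp G E; have [->|->] := ec_same_x E (sub _ G); first exact: G.
exact: opp.
Qed.

(** * The lower bound for the canonical height *)

Unset Implicit Arguments.

Theorem theorem7 (R : realType) (E : weierstrass int)
    (Gamma : set (ec_point rat)) (r : nat)
    (hE : discriminant E != 0)
    (hr : has_rank (over_rat E) (ec_points (over_rat E)) r)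
    (r_ge1 : (1 <= r)%N)
    (hGamma : ec_subgroup (over_rat E) Gamma)
    (hs : has_rank (over_rat E) Gamma 0) :
  exists C x0 : R, forall x : R, x0 <= x ->
    forall Q : ec_point rat, pseudolinearly_dependent E Gamma x Q ->
      (#|` fset_set Gamma|)%fset%:R^-1 * (x / ln x) - C * (x / ln x ^+ 2)
        <= canonical_height R (over_rat E) Q.
Proof.
have [C hC] := canonical_height_lower R hE.
(* If Gamma were infinite, fset_set Gamma would be empty and 0^-1 = 0. *)
exists 0; case: (pselect (finite_set Gamma)) => [fin|inf]; last first.
  exists 0 => x _ Q [EQ _ _].
  have -> : fset_set Gamma = fset0 by rewrite /fset_set; case: pselect.
  rewrite cardfs0 invr0 !mul0r subr0.
  by case: (hC _ EQ).
set k := #|` fset_set Gamma|%fset.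
pose f T := (2 * mul_height T)%N.
(* The part independent of Q in the bound for the integer [M] below. *)
pose B := (`|discriminant E| * \prod_(T <- fset_set Gamma) f T)%N.
have f_gt0 T : (0 < f T)%N by rewrite muln_gt0 mul_height_gt0.
have B0 : (0 < B)%N by rewrite muln_gt0 absz_gt0 hE prodn_gt0.
(* The power of [hq] in [M_le] is k + 1, and the 2 compensates the half in [hQ]. With these A and K,
   ln hq >= 2 (z + |C|) for z = x / ln x. *)
pose A : R := 2 * k.+1%:R.
have lnB : 0 <= ln B%:R :> R by rewrite ln_ge0 // ler1n.
have [x0 [x02 hx0]] := primorial_growth (A := A) (K := ln B%:R + A * `|C|)
  ltac:(by rewrite mulr_ge0) ltac:(by rewrite addr_ge0 // mulr_ge0 // mulr_ge0).
exists x0 => x x0x [[xQ yQ]|] [EQ nGQ red]; last by case: hGamma nGQ.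
have x_ge0 : 0 <= x by lra.
have /andP[n1 n2] := truncn_itv x_ge0.
have := hx0 x _ x0x n1 n2; set n := Num.truncn x in n1 n2 *.
have [_ hQ] := hC _ EQ; rewrite naive_heightE in hQ.
set hq := mul_height _ in hQ.
(* At infinity the factor is 1: if Q reduces to the reduction of that point, then p already divides
   [denq xQ]. *)
pose g (T : ec_point rat) := if T is Some (x', _) then cross xQ x' else 1.
have g_neq0 T : Gamma T -> g T != 0.
  case: T => [[x' y']|] //= GT; apply/eqP => /cross_eq0 e; subst x'.
  by apply: nGQ; apply: same_x_in_subgroup hGamma GT EQ.
have g_le T : (`|g T| <= f T * hq)%N.
  case: T => [[x' y']|]; last by rewrite /f muln1 muln_gt0 mul_height_gt0.
  by rewrite /f -mulnA [(mul_height _ * _)%N]mulnC mulnA absz_cross_le.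
(* The discriminant accounts for the primes of bad reduction, so that every prime up to n divides
   M. *)
pose M := (`|discriminant E| * (`|denq xQ| * \prod_(T <- fset_set Gamma) `|g T|))%N.
have M0 : (0 < M)%N.
  rewrite !muln_gt0 !absz_gt0 hE denq_neq0 /=.
  rewrite big_seq_cond prodn_cond_gt0 // => T /andP[]; rewrite in_fset_set // inE => GT _.
  by rewrite absz_gt0 g_neq0.
have M_le : (M <= B * hq ^ k.+1)%N.
  rewrite /M /B -mulnA leq_mul2l expnS mulnCA; apply/orP; right.
  apply: leq_mul; first by rewrite leq_maxr.
  apply: leq_trans (leq_prod (fun T _ => g_le T)) _.
  by rewrite big_split leq_mul2l /= big_const_seq count_predT iter_muln_1 leqnn orbT.
have dvd : (primorial n %| M)%N.
  apply: primorial_dvd => p pp pn.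
  have [pD|pD] := boolP (p%:Z %| discriminant E)%Z.
    by rewrite dvdn_mulr // -[p]absz_nat -dvdzE.
  have px : p%:R <= x by apply: le_trans n1; rewrite ler_nat.
  have [T GT eT] := red p (conj pp pD) px.
  apply: dvdn_mull; case: (reduction_eq pp eT) => [pd|[x' [y' [eT' pd]]]].
    by rewrite dvdn_mulr // -[p]absz_nat -dvdzE.
  apply: dvdn_mull.
  rewrite (big_fsetD1 T) ?in_fset_set ?inE //= dvdn_mulr // eT'.
  by rewrite -[p]absz_nat -dvdzE.
have hq0 : (0 < hq)%N by exact: mul_height_gt0.
have := ln_nat_le R (primorial_gt0 n) (leq_trans (dvdn_leq M0 dvd) M_le).
rewrite ln_natM ?expn_gt0 ?hq0 // ln_natX // => up low.
rewrite mul0r subr0; apply: le_trans hQ.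
set z := x / ln x in low *.
have z0 : 0 <= z by rewrite divr_ge0 // ln_ge0 //; lra.
(* The bound reached is z itself, so the error term can be taken to be 0. For k = 0 the inverse is 0
   by convention. *)
have kz : k%:R^-1 * z <= z.
  rewrite ler_piMl //; case: (k) => [|k']; first by rewrite invr0.
  by rewrite invf_le1 ?ltr0n // ler1n.
have hz : k.+1%:R * (2 * (z + `|C|)) <= k.+1%:R * ln hq%:R.
  have -> : k.+1%:R * (2 * (z + `|C|)) = A * z + A * `|C| by rewrite /A; ring.
  lra.
rewrite ler_pM2l ?ltr0n // in hz.
have := ler_norm C; lra.
Qed.
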